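(* Assume that the concave penalty function $\sigma\mapsto P(\sigma;\lambda,\gamma)$ on $\sigma\ge0$ is differentiable with bounded gradient. Let $\ell\ge0$, $X_1\in\mathbb{R}^{m\times n}$, and $X_{k+1}\in\operatorname*{arg\,min}_XF_\ell(X;X_k)$ for $k\ge1$. Let $U_k\operatorname{diag}(\boldsymbol\sigma_k)V_k'$ denote the rank-reduced SVD of $X_k$. Let $\bar U\in\mathbb{R}^{m\times r}$, $\bar V\in\mathbb{R}^{n\times r}$ denote a limit point of the sequence $\{U_k,V_k\}$, $k\ge1$, such that $(U_{n_k},V_{n_k})\to(\bar U,\bar V)$ along a subsequence $n_k\to\infty$. Let $\bar u_i$ and $\bar v_i$ denote the $i$th columns of $\bar U$ and $\bar V$, and let $$ \bar\Theta=\left[\operatorname{vec}(\mathcal P_\Omega(\bar u_1\bar v_1')),\ldots,\operatorname{vec}(\mathcal P_\Omega(\bar u_r\bar v_r'))\right]\in\mathbb{R}^{mn\times r}. $$ Then: (a) If $\operatorname{rank}(\bar\Theta)=r$, then the sequence $X_{n_k}$ has a limit point which is a first order stationary point. (b) If $\lambda_{\min}(\bar\Theta'\bar\Theta)+\phi_P>0$, then the sequence $X_{n_k}$ converges to a first order stationary point $\bar X=\bar U\operatorname{diag}(\bar{\boldsymbol\sigma})\bar V'$, where $\boldsymbol\sigma_{n_k}\to\bar{\boldsymbol\sigma}$.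
   Context: Setting: $m,n$ are positive integers, $\Omega\subset\{1,\dots,m\}\times\{1,\dots,n\}$, $Y\in\mathbb{R}^{m\times n}$ (only the entries in $\Omega$ matter). For a matrix $A$, $\mathcal P_\Omega(A)$ has $(i,j)$ entry $a_{ij}$ if $(i,j)\in\Omega$ and $0$ otherwise, and $\mathcal P_\Omega^\perp(A)=A-\mathcal P_\Omega(A)$. $\sigma_1(X)\ge\sigma_2(X)\ge\cdots$ are the singular values of $X$; $\operatorname{vec}$ stacks the entries of a matrix into a vector; $\lambda_{\min}$ is the smallest eigenvalue. ''Rank-reduced SVD'' means that only the strictly positive singular values (and corresponding singular vectors) are kept. The parameters $(\lambda,\gamma)$ are fixed and $\sigma\mapsto P(\sigma;\lambda,\gamma)$ is a real-valued concave, nondecreasing penalty function on $[0,\infty)$, with $$\phi_P := \inf_{\alpha,\alpha'>0,\ \alpha\neq\alpha'} \frac{P'(\alpha;\lambda,\gamma)-P'(\alpha';\lambda,\gamma)}{\alpha-\alpha'}\in[-\infty,0].$$ Define $$ f(X)=\tfrac12\|\mathcal P_\Omega(X-Y)\|_F^2+\sum_{i=1}^{\min\{m,n\}}P(\sigma_i(X);\lambda,\gamma), $$ $$ F_\ell(X;X_k)=\tfrac12\|\mathcal P_\Omega(X-Y)\|_F^2+\tfrac12\|\mathcal P_\Omega^\perp(X-X_k)\|_F^2+\tfrac{\ell}{2}\|X-X_k\|_F^2+\sum_{i=1}^{\min\{m,n\}}P(\sigma_i(X);\lambda,\gamma), $$ $$ \nu(\ell)=1+\phi_P+\ell,\qquad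 \nu^\dagger(\ell)=\max\{\nu(\ell),0\}, $$ $$ \Delta_\ell(X_k;X_{k+1})=\tfrac{\nu^\dagger(\ell)+\ell}{2}\|X_{k+1}-X_k\|_F^2+\tfrac12\|\mathcal P_\Omega^\perp(X_{k+1}-X_k)\|_F^2. $$ $X_a\in\mathbb{R}^{m\times n}$ is said to be a first order stationary point (of the problem of minimizing $f$) if $\Delta_\ell(X_a;X_{a+1})=0$, where $X_{a+1}\in\operatorname*{arg\,min}_XF_\ell(X;X_a)$. *)

(* Defs.v *)
From HB Require Import structures.
From mathcomp Require Export all_boot all_order all_algebra.
From mathcomp Require Export all_classical all_reals all_analysis.
From mathcomp Require Import polyrcf.
Export Order.TTheory GRing.Theory Num.Theory.
Export numFieldNormedType.Exports.

Set Implicit Arguments.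
Unset Strict Implicit.
Unset Printing Implicit Defensive.

Local Open Scope classical_set_scope.
Local Open Scope ring_scope.

Section Matrices.
Variable R : realType.

Definition frob_norm m n (A : 'M[R]_(m, n)) : R :=
  Num.sqrt (\sum_i \sum_j A i j ^+ 2).

Definition P_Omega m n (Omega : {set 'I_m * 'I_n}) (A : 'M[R]_(m, n)) :
    'M[R]_(m, n) :=
  \matrix_(i, j) (if (i, j) \in Omega then A i j else 0).

Definition P_Omega_perp m n (Omega : {set 'I_m * 'I_n}) (A : 'M[R]_(m, n)) :
    'M[R]_(m, n) :=
  A - P_Omega Omega A.

(* Real eigenvalues repeated according to their algebraic multiplicity, in
   nonincreasing order; for a symmetric [A] these are all [n] eigenvalues. *)
Definition sorted_eigenvalues n (A : 'M[R]_n) : seq R :=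
  sort >=%R (flatten [seq nseq (mup x (char_poly A)) x
                     | x <- rootsR (char_poly A)]).

(* The index is 0-based: [singular_value X 0] is the largest singular value. *)
Definition singular_value m n (X : 'M[R]_(m, n)) (i : nat) : R :=
  Num.sqrt (sorted_eigenvalues (X^T *m X))`_i.

(* The infimum over a finite set, hence a minimum unless the set is empty,
   which for a symmetric matrix happens only when [n = 0] (value [+oo]). *)
Definition lambda_min n (A : 'M[R]_n) : \bar R :=
  ereal_inf [set a%:E | a in [set a | eigenvalue A a]].

Definition rank_reduced_svd m n r (X : 'M[R]_(m, n))
    (U : 'M[R]_(m, r)) (s : 'rV[R]_r) (V : 'M[R]_(n, r)) : Prop :=
  [/\ X = U *m diag_mx s *m V^T,
      U^T *m U = 1%:M,
      V^T *m V = 1%:M,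
      (forall i, 0 < s 0 i) &
      (forall i j : 'I_r, (i <= j)%N -> s 0 j <= s 0 i)].

(* Convergence to a p x r matrix of a sequence whose number of columns may
   vary: the number of columns is eventually [r], and the entries converge.
   The padding value of [conform_mx] is thus irrelevant. *)
Definition cvg_mx p r (d : nat -> nat) (A : forall k, 'M[R]_(p, d k))
    (B : 'M[R]_(p, r)) : Prop :=
  (\forall k \near \oo, d k = r) /\
  (conform_mx (0 : 'M[R]_(p, r)) (A k) @[k --> \oo] --> B).

Definition Theta m n r (Omega : {set 'I_m * 'I_n})
    (U : 'M[R]_(m, r)) (V : 'M[R]_(n, r)) : 'M[R]_(m * n, r) :=
  \matrix_(p < m * n, i < r)
    mxvec (P_Omega Omega (col i U *m (col i V)^T)) 0 p.

End Matrices.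

Section Penalty.
Variables (R : realType) (P : R -> R).

Definition concave_nonneg : Prop :=
  convex_function (`[0, +oo[%classic : set R^o) (fun x => - P x).

Definition nondecreasing_nonneg : Prop :=
  forall x y : R, 0 <= x -> x <= y -> P x <= P y.

(* Differentiability on the closed half-line [0, +oo[, one-sided at 0; since
   the derivative at 0 is a single number, bounding it on ]0, +oo[ suffices. *)
Definition differentiable_bounded_gradient : Prop :=
  [/\ (forall x : R, 0 < x -> derivable P x 1),
      cvg ((P h - P 0) / h @[h --> 0^'+]) &
      exists M : R, forall x : R, 0 < x -> `|derive1 P x| <= M].

Definition phi_P : \bar R :=
  ereal_inf [set z | exists a b : R, [/\ 0 < a, 0 < b, a != b &
                       z = ((derive1 P a - derive1 P b) / (a - b))%:E]].

Definition nu (l : R) : \bar R := (1 + phi_P + l%:E)%E.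

Definition nu_dagger (l : R) : \bar R := maxe (nu l) 0%E.

End Penalty.

Section Problem.
Variables (R : realType) (m n : nat) (Omega : {set 'I_m * 'I_n}).
Variables (Y : 'M[R]_(m, n)) (P : R -> R).

Definition F_surrogate (l : R) (X Xk : 'M[R]_(m, n)) : R :=
  2^-1 * frob_norm (P_Omega Omega (X - Y)) ^+ 2
  + 2^-1 * frob_norm (P_Omega_perp Omega (X - Xk)) ^+ 2
  + l / 2 * frob_norm (X - Xk) ^+ 2
  + \sum_(i < minn m n) P (singular_value X i).

Definition argmin_F (l : R) (Xk : 'M[R]_(m, n)) : set 'M[R]_(m, n) :=
  [set X | forall Z, F_surrogate l X Xk <= F_surrogate l Z Xk].

(* Extended-real valued only because [phi_P] is; [nu_dagger P l] is finite as
   soon as [phi_P P < +oo]. *)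
Definition Delta (l : R) (Xk Xk1 : 'M[R]_(m, n)) : \bar R :=
  ((nu_dagger P l + l%:E) * (2^-1 * frob_norm (Xk1 - Xk) ^+ 2)%:E
   + (2^-1 * frob_norm (P_Omega_perp Omega (Xk1 - Xk)) ^+ 2)%:E)%E.

Definition first_order_stationary (l : R) (Xa : 'M[R]_(m, n)) : Prop :=
  exists2 Xa1, argmin_F l Xa Xa1 & Delta l Xa Xa1 = 0%E.

End Problem.

(* Main.v *)
(** Write [f] for the objective. Since [f Z <= F_l(Z; X_k)] with equality at
    [Z = X_k], the values [f(X_k)] decrease to a limit [f*]. If [X_(n_k)] tends
    to [Xbar] along some filter, then [F_l(Z; X_(n_k)) >= f(X_(n_k + 1)) >= f*]
    passes to the limit and gives [F_l(Z; Xbar) >= f* = f(Xbar) = F_l(Xbar; Xbar)]: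
    [Xbar] minimizes its own surrogate, hence is stationary, and no estimate on
    [X_(k+1) - X_k] is needed.

    Limit points exist because [Theta_k s_k = vec (P_Omega X_k)] is bounded by the
    objective while [Theta_k] tends to a matrix of full column rank, so [s_k] is
    bounded. Continuity of [f] along the sequence only involves the vectors [s_k],
    because the singular values of [U diag(s) V'] are the entries of [s >= 0] padded
    with zeros, even when the limit loses rank.

    For (b), on the orthant [s >= 0] the map [s |-> f(Ubar diag(s) Vbar')] is
    strongly convex, and two limits [s], [t] of [s_(n_k)] give the same value [f*];
    moving from [s] to [(1 - tau) s + tau t], the proximal terms of the surrogate
    cost only [O(tau^2)], so minimality at [s] forces [s = t]. *)

From mathcomp Require Import polyrcf zify ring lra.
Require Import Defs.

Set Implicit Arguments.
Unset Strict Implicit.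
Unset Printing Implicit Defensive.

Local Open Scope classical_set_scope.
Local Open Scope ring_scope.

(** * Characteristic polynomials and the penalty sum of a factored matrix *)

(** Sylvester's identity: the block matrix [M] with rows ['X, A] and [B, 1] is made block triangular
    by two different right multiplications, and the determinants are compared. *)
Lemma char_poly_mulmxC (R : comNzRingType) (n r : nat)
    (A : 'M[R]_(n, r)) (B : 'M[R]_(r, n)) :
  'X^r * char_poly (A *m B) = 'X^n * char_poly (B *m A).
Proof.
pose A' := map_mx polyC A; pose B' := map_mx polyC B.
pose M : 'M[{poly R}]_(n + r) := block_mx ('X)%:M A' B' 1%:M.
have detM : \det M = char_poly (A *m B).
  have := congr1 determinant (mulmx_block ('X)%:M A' B' 1%:M 1%:M 0 (- B') 1%:M).
  rewrite det_mulmx (det_lblock _ (- B')) !det1 !mulr1 => ->.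
  rewrite !mulmx1 !mul1mx !mulmxN subrr !mulmx0 add0r det_ublock.
  rewrite add0r det1 mulr1.
  by rewrite -map_mxM.
have := congr1 determinant (mulmx_block ('X)%:M A' B' 1%:M 1%:M (- A') 0 ('X)%:M).
rewrite det_mulmx det_ublock det1 mul1r det_scalar [\det _]detM mulrC => ->.
rewrite !mulmx1 !mul1mx !mulmxN !mulmx0 addr0 mul_scalar_mx mul_mx_scalar.
rewrite addNr addr0 det_lblock det_scalar.
by rewrite [- _ + _]addrC -map_mxM.
Qed.

Lemma char_poly_diag (R : comNzRingType) (n : nat) (s : 'rV[R]_n) :
  char_poly (diag_mx s) = \prod_i ('X - (s 0 i)%:P).
Proof.
rewrite char_poly_trig; first by apply: eq_bigr => i _; rewrite mxE eqxx.
by apply/is_trig_mxP => i j /ltn_eqF ij; rewrite mxE -val_eqE /= ij.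
Qed.

Section SpectralSum.
Variable R : realType.

(** Both lists contain each [x] as often as its multiplicity as a root of [char_poly A], so they are
    permutations of each other. *)
Lemma sorted_eigenvalues_prod_XsubC (n : nat) (A : 'M[R]_n) (L : seq R) :
  char_poly A = \prod_(x <- L) ('X - x%:P) ->
  sorted_eigenvalues A = sort >=%R L.
Proof.
move=> charA; rewrite /sorted_eigenvalues; apply/perm_sortP => //.
- exact: ge_total.
- exact: ge_trans.
- exact: ge_anti.
apply/allP => x _ /=; apply/eqP; rewrite count_flatten -map_comp.
rewrite -mu_prod_XsubC -charA; set p := char_poly A.
have p0 : p != 0 by rewrite monic_neq0 ?char_poly_monic.
rewrite sumnE big_map.
under eq_bigr => y _ do rewrite /= count_nseq /= mulnC.
have [xp|xp] := boolP (root p x).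
  rewrite (bigD1_seq x) //=; first last.
  - exact: polyrcf.uniq_roots.
  - by have := roots_on_rootsR p0 x; rewrite in_itv /= xp => <-.
  rewrite eqxx muln1 big1 ?addn0 // => y yx; rewrite (negbTE yx) muln0 //.
rewrite mupNroot // big1_seq // => y /= _.
by case: (y =P x) => [->|_]; rewrite ?muln0 // mupNroot.
Qed.

Lemma sort_ge_cat_nseq0 (L : seq R) (k : nat) : {in L, forall x, 0 <= x} ->
  sort >=%R (L ++ nseq k 0) = sort >=%R L ++ nseq k 0.
Proof.
move=> L0; apply: (@sorted_eq _ (>=%R : rel R)).
- exact: ge_trans.
- exact: ge_anti.
- exact: (sort_sorted (@ge_total _ R)).
- rewrite (sorted_pairwise (@ge_trans _ R)) pairwise_cat.
  rewrite -!(sorted_pairwise (@ge_trans _ R)) (sort_sorted (@ge_total _ R)).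
  apply/andP; split.
    apply/allrelP => x y; rewrite mem_sort => /L0 x0.
    by rewrite mem_nseq => /andP[_ /eqP ->].
  by elim: k => //= -[//|k] /= ->; rewrite lexx.
- by rewrite perm_sort perm_cat2r perm_sym perm_sort.
Qed.

Lemma orthonormal_cols_leq (m r : nat) (U : 'M[R]_(m, r)) :
  U^T *m U = 1%:M -> (r <= m)%N.
Proof. exact: mulmx1_min. Qed.

(** Since [X^T *m X] equals [V *m diag_mx D *m V^T], its characteristic polynomial is that of
    [diag_mx D] times a power of ['X]. The entries of [s] may vanish and need no order, so the
    formula also covers limits and convex combinations. *)
Lemma sum_penalty_svd (m n r : nat) (P : R -> R) (U : 'M[R]_(m, r))
    (s : 'rV[R]_r) (V : 'M[R]_(n, r)) :
  U^T *m U = 1%:M -> V^T *m V = 1%:M -> (forall i, 0 <= s 0 i) ->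
  \sum_(i < minn m n) P (singular_value (U *m diag_mx s *m V^T) i) =
  \sum_i P (s 0 i) + P 0 *+ (minn m n - r).
Proof.
move=> U1 V1 s0; set X := U *m _ *m _.
have rm := orthonormal_cols_leq U1; have rn := orthonormal_cols_leq V1.
have rmn : (r <= minn m n)%N by rewrite leq_min rm.
pose D : 'rV[R]_r := \row_i (s 0 i) ^+ 2.
have XX : X^T *m X = V *m (diag_mx D *m V^T).
  rewrite /X !trmx_mul trmxK tr_diag_mx !mulmxA.
  rewrite -(mulmxA _ U^T U) U1 mulmx1 -(mulmxA V (diag_mx s)) mulmx_diag.
  by congr (_ *m _ *m _); congr diag_mx; apply/rowP => i; rewrite !mxE expr2.
pose L := [seq (s 0 i) ^+ 2 | i : 'I_r].
have sizeL : size L = r by rewrite size_map size_enum_ord.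
have L0 : {in L, forall x, 0 <= x} by move=> _ /mapP[i _ ->]; exact: sqr_ge0.
have charX : char_poly (X^T *m X) = \prod_(x <- L ++ nseq (n - r) 0) ('X - x%:P).
  have := char_poly_mulmxC V (diag_mx D *m V^T).
  rewrite -mulmxA V1 mulmx1 -XX char_poly_diag.
  have -> : ('X^n : {poly R}) = 'X^r * 'X^(n - r) by rewrite -exprD subnKC.
  rewrite -mulrA.
  move/(mulfI (expf_neq0 _ (negbT (polyX_eq0 R)))) => ->.
  rewrite big_cat /= mulrC big_map big_enum /=; congr (_ * _).
    by apply: eq_bigr => i _; rewrite mxE.
  by rewrite big_nseq subr0 iter_mulr_1.
(* The [n - r] zeros are split so that the first block has exactly the [minn m n] eigenvalues that
   enter the sum. *)
have eL : sorted_eigenvalues (X^T *m X) =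
    sort >=%R (L ++ nseq (minn m n - r) 0) ++ nseq (n - minn m n) 0.
  rewrite (sorted_eigenvalues_prod_XsubC charX).
  rewrite -sort_ge_cat_nseq0 -?catA; last first.
    by move=> x; rewrite mem_cat => /orP[/L0//|]; rewrite mem_nseq => /andP[_ /eqP->].
  rewrite -nseqD; congr (sort _ (_ ++ nseq _ _)).
  have := geq_minr m n; lia.
rewrite /singular_value eL.
set L' := L ++ _ in eL *.
have sizeL' : size (sort >=%R L') = minn m n.
  by rewrite size_sort size_cat sizeL size_nseq subnKC.
transitivity (\sum_(x <- sort >=%R L') P (Num.sqrt x)).
  rewrite (big_nth 0) sizeL' big_mkord; apply: eq_bigr => i _.
  by rewrite nth_cat sizeL' ltn_ord.
rewrite (perm_big _ (permEl (perm_sort _ _))) /L' big_cat /=; congr (_ + _).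
  rewrite big_map big_enum /=; apply: eq_bigr => i _.
  by rewrite sqrtr_sqr ger0_norm.
by rewrite big_nseq sqrtr0 iter_addr_0.
Qed.

End SpectralSum.

(** * Continuity and weak convexity of the penalty *)

Section PenaltyFunction.
Variables (R : realType) (P : R -> R).
Hypothesis P_diff : differentiable_bounded_gradient P.

(* [P] is only known on the half-line; composing with [`|.|] extends it evenly,
   so that one-sided continuity at [0] becomes continuity on the whole line. *)
Lemma continuous_penalty_norm : continuous (fun x : R => P `|x|).
Proof.
case: P_diff => dP /cvg_ex[/= dP0 cvgP0] _ x.
have [->|xn0] := eqVneq x 0; last first.
  apply: continuous_comp; first exact: norm_continuous.
  apply: differentiable_continuous; apply/derivable1_diffP/dP.
  by rewrite normr_gt0.
(* Right continuity at 0 follows from the one-sided derivative by writing [P h] as [h] times the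
   difference quotient plus [P 0]. *)
have right_cvg : P h @[h --> 0^'+] --> P 0.
  have h_cvg : (h : R) @[h --> 0^'+] --> (0 : R).
    exact: cvg_within.
  have := cvgD (cvgM h_cvg cvgP0) (cvg_cst (P 0)).
  rewrite mul0r add0r => hP; apply: (cvg_trans _ (hP _ _ _)); apply: near_eq_cvg.
  near=> h; rewrite fctE /= mulrC divfK ?subrK //.
apply/cvgrPdist_lt => e e0; rewrite normr0.
move/cvgrPdist_lt: right_cvg => /(_ e e0) [d /= d0 dP'].
exists d => //= y; rewrite /= sub0r normrN => yd.
have [->|yn0] := eqVneq y 0; first by rewrite normr0 subrr normr0.
by apply: dP' => /=; rewrite ?sub0r ?normrN ?normr_id ?normr_gt0.
Unshelve. all: by end_near. Qed.

(** The function [g], which is [P] minus [c / 2 * x ^+ 2], has a nondecreasing derivative, hence is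
    convex. The mean value theorem on both sides of [z] gives the inequality, and it needs only
    continuity at the endpoint [a], which may be 0. *)
Lemma weak_convexity_lt (c a b t : R) : (c%:E <= phi_P P)%E ->
  0 <= a -> a < b -> 0 < t < 1 ->
  P ((1 - t) * a + t * b) <=
  (1 - t) * P a + t * P b - c / 2 * (t * (1 - t)) * (a - b) ^+ 2.
Proof.
move=> cphi a0 ab /andP[t0 t1]; set z := _ * a + _.
have az : a < z by rewrite /z; nra.
have zb : z < b by rewrite /z; nra.
pose g x := P x - c / 2 * x ^+ 2.
have dg (x : R) : 0 < x -> is_derive x 1 g (derive1 P x - c * x).
  move=> x0; case: P_diff => dP _ _.
  have dPx : is_derive x 1 P (derive1 P x).
    by rewrite derive1E; apply: derivableP; exact: dP.
  apply: is_derive_eq; rewrite /GRing.scale /=; lra.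
have cg (u v : R) : 0 <= u -> {within `[u, v], continuous g}.
  move=> u0; apply: (@subspace_eq_continuous R `[u, v]%classic R
    (fun x : R => P `|x| - c / 2 * x ^+ 2) g).
    move=> y /set_mem /=; rewrite in_itv /= => /andP[uy _].
    by rewrite ger0_norm // (le_trans u0).
  apply: continuous_subspaceT => y; apply: cvgB; first exact: continuous_penalty_norm.
  by apply: cvgM; [exact: cvg_cst|exact: exprn_continuous].
have z0 : 0 <= z by lra.
have [|x1 /[!in_itv] /= /andP[ax1 x1z] e1] :=
  @MVT R g (fun x => derive1 P x - c * x) a z az _ (cg a z a0).
  by move=> y; rewrite in_itv /= => /andP[ay _]; apply: dg; lra.
have [|x2 /[!in_itv] /= /andP[zx2 x2b] e2] :=
  @MVT R g (fun x => derive1 P x - c * x) z b zb _ (cg z b z0).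
  by move=> y; rewrite in_itv /= => /andP[ay _]; apply: dg; lra.
(* This is where [phi_P] enters: it makes the slope of [g] at [x1] at most its slope at [x2]. *)
have : c <= (derive1 P x1 - derive1 P x2) / (x1 - x2).
  rewrite -lee_fin; apply: (le_trans cphi); apply: ereal_inf_lbound.
  by exists x1, x2; split => //; [lra|lra|rewrite lt_eqF //; lra].
rewrite ler_ndivlMr; last by lra.
move=> dle; rewrite /g in e1 e2.
have za : z - a = t * (b - a) by rewrite /z; ring.
have bz : b - z = (1 - t) * (b - a) by rewrite /z; ring.
rewrite za in e1; rewrite bz in e2.
set d1 := derive1 P x1 - c * x1 in e1; set d2 := derive1 P x2 - c * x2 in e2.
have d12 : d1 <= d2 by rewrite /d1 /d2; lra.
have : (1 - t) * (d1 * (t * (b - a))) <= t * (d2 * ((1 - t) * (b - a))).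
  have -> : (1 - t) * (d1 * (t * (b - a))) = d1 * (t * (1 - t) * (b - a)) by ring.
  have -> : t * (d2 * ((1 - t) * (b - a))) = d2 * (t * (1 - t) * (b - a)) by ring.
  by apply: ler_wpM2r d12; rewrite !mulr_ge0 //; lra.
rewrite -e1 -e2 => main.
suff : z ^+ 2 = (1 - t) * a ^+ 2 + t * b ^+ 2 - t * (1 - t) * (a - b) ^+ 2 by nra.
by rewrite /z; ring.
Qed.

Lemma weak_convexity (c a b t : R) : (c%:E <= phi_P P)%E ->
  0 <= a -> 0 <= b -> 0 < t < 1 ->
  P ((1 - t) * a + t * b) <=
  (1 - t) * P a + t * P b - c / 2 * (t * (1 - t)) * (a - b) ^+ 2.
Proof.
move=> cphi a0 b0 t01; have [ab|ba|<-] := ltgtP a b.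
- exact: weak_convexity_lt.
- have t01' : 0 < 1 - t < 1 by lra.
  have := weak_convexity_lt cphi b0 ba t01'.
  rewrite subKr addrC => /le_trans; apply; rewrite -subr_ge0 le_eqVlt.
  by apply/orP; left; apply/eqP; ring.
- have -> : (1 - t) * a + t * a = a by ring.
  by rewrite subrr expr0n /= mulr0 subr0 -mulrDl subrK mul1r.
Qed.

End PenaltyFunction.

(** * Entrywise convergence of matrices *)

Lemma frob_normE (R : realType) (m n : nat) (A : 'M[R]_(m, n)) :
  frob_norm A ^+ 2 = \sum_i \sum_j A i j ^+ 2.
Proof. by rewrite sqr_sqrtr //; do 2 (apply: sumr_ge0 => ? _); exact: sqr_ge0. Qed.

Section MatrixLimits.
Variables (R : realType) (T : Type) (F : set_system T).
Context {FF : Filter F}.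

Lemma cvg_sum (I : Type) (s : seq I) (f : I -> T -> R) (l : I -> R) :
  (forall i, f i x @[x --> F] --> l i) ->
  \sum_(i <- s) f i x @[x --> F] --> \sum_(i <- s) l i.
Proof. by move=> fl; apply: cvg_big => [|i _]; [exact: add_continuous|exact: fl]. Qed.

Lemma cvg_mx_entries (m n : nat) (A : T -> 'M[R]_(m, n)) (B : 'M[R]_(m, n)) :
  (A x @[x --> F] --> B) <-> (forall i j, A x i j @[x --> F] --> B i j).
Proof.
split=> [AB i j|AB W [Q BQ QW]].
  exact: (continuous_cvg _ (@coord_continuous R m n i j B) AB).
apply: filterS QW _; apply: filter_forall => i; apply: filter_forall => j.
exact: AB (BQ i j).
Qed.

Lemma cvg_mulmx (m n p : nat) (A : T -> 'M[R]_(m, n)) (B : T -> 'M[R]_(n, p))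
    (a : 'M[R]_(m, n)) (b : 'M[R]_(n, p)) :
  A x @[x --> F] --> a -> B x @[x --> F] --> b ->
  A x *m B x @[x --> F] --> a *m b.
Proof.
move=> /cvg_mx_entries Aa /cvg_mx_entries Bb; apply/cvg_mx_entries => i j.
under eq_fun do rewrite mxE; rewrite mxE.
by apply: cvg_sum => k; exact: cvgM.
Qed.

Lemma cvg_trmx (m n : nat) (A : T -> 'M[R]_(m, n)) (a : 'M[R]_(m, n)) :
  A x @[x --> F] --> a -> (A x)^T @[x --> F] --> a^T.
Proof.
move=> /cvg_mx_entries Aa; apply/cvg_mx_entries => i j.
by under eq_fun do rewrite mxE; rewrite mxE; exact: Aa.
Qed.

Lemma cvg_diag_mx (n : nat) (A : T -> 'rV[R]_n) (a : 'rV[R]_n) :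
  A x @[x --> F] --> a -> diag_mx (A x) @[x --> F] --> diag_mx a.
Proof.
move=> /cvg_mx_entries Aa; apply/cvg_mx_entries => i j.
under eq_fun do rewrite mxE; rewrite mxE.
by case: (i == j); [exact: Aa|exact: cvg_cst].
Qed.

Lemma cvg_P_Omega (m n : nat) (Omega : {set 'I_m * 'I_n})
    (A : T -> 'M[R]_(m, n)) (a : 'M[R]_(m, n)) :
  A x @[x --> F] --> a -> P_Omega Omega (A x) @[x --> F] --> P_Omega Omega a.
Proof.
move=> /cvg_mx_entries Aa; apply/cvg_mx_entries => i j.
under eq_fun do rewrite mxE; rewrite mxE.
by case: ifP => _; [exact: Aa|exact: cvg_cst].
Qed.

Lemma cvg_P_Omega_perp (m n : nat) (Omega : {set 'I_m * 'I_n})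
    (A : T -> 'M[R]_(m, n)) (a : 'M[R]_(m, n)) :
  A x @[x --> F] --> a ->
  P_Omega_perp Omega (A x) @[x --> F] --> P_Omega_perp Omega a.
Proof. by move=> Aa; apply: cvgB => //; exact: cvg_P_Omega. Qed.

Lemma cvg_frob_norm_sqr (m n : nat) (A : T -> 'M[R]_(m, n)) (a : 'M[R]_(m, n)) :
  A x @[x --> F] --> a -> frob_norm (A x) ^+ 2 @[x --> F] --> frob_norm a ^+ 2.
Proof.
move=> /cvg_mx_entries Aa; rewrite frob_normE.
under eq_fun do rewrite frob_normE.
by do 2 (apply: cvg_sum => ?); apply: cvgM; exact: Aa.
Qed.

End MatrixLimits.

(** * Smallest eigenvalue of a symmetric matrix, and the sign of [phi_P] *)

Lemma quad_formD (R : comRingType) (n : nat) (A : 'M[R]_n) (x y : 'rV[R]_n) (t : R) :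
  A^T = A ->
  (x + t *: y) *m A *m (x + t *: y)^T =
  x *m A *m x^T + (2 * t) *: (x *m A *m y^T) + t ^+ 2 *: (y *m A *m y^T).
Proof.
move=> symA; have symxy : y *m A *m x^T = x *m A *m y^T.
  have <- : (x *m A *m y^T)^T = y *m A *m x^T.
    by rewrite !trmx_mul trmxK symA mulmxA.
  by apply/matrixP => i j; rewrite !ord1 mxE.
rewrite linearD /= linearZ /= !mulmxDl !mulmxDr -!scalemxAl -!scalemxAr symxy.
rewrite scalerA -expr2 -!addrA; congr (_ + _).
by rewrite addrA -scalerDl [2 * t]mulr_natl mulr2n.
Qed.

(** The quadratic form attains its minimum [a] on the compact unit sphere at some [x0]. The form of
    [A - a%:M] is then nonnegative and vanishes at [x0], which makes [x0] an eigenvector. *)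
Lemma symmetric_min_eigenvalue (R : realType) (n : nat) (A : 'M[R]_n) :
  (0 < n)%N -> A^T = A ->
  exists2 a, eigenvalue A a &
    forall x : 'rV[R]_n, a * (x *m x^T) 0 0 <= (x *m A *m x^T) 0 0.
Proof.
case: n A => // n A _ symA.
pose S := [set x : 'rV[R]_n.+1 | (x *m x^T) 0 0 = 1].
pose f (x : 'rV[R]_n.+1) := (x *m A *m x^T) 0 0.
have sqE (x : 'rV[R]_n.+1) : (x *m x^T) 0 0 = \sum_i x 0 i ^+ 2.
  by rewrite mxE; apply: eq_bigr => i _; rewrite mxE expr2.
have cid (x : 'rV[R]_n.+1) : y @[y --> x] --> x by exact: cvg_id.
have cf : continuous f.
  move=> x.
  have xAx : y *m A *m y^T @[y --> x] --> x *m A *m x^T.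
    exact: (cvg_mulmx (cvg_mulmx (cid x) (cvg_cst A)) (cvg_trmx (cid x))).
  exact: (proj1 (cvg_mx_entries _ _) xAx 0 0).
have cq : continuous (fun x : 'rV[R]_n.+1 => (x *m x^T) 0 0).
  move=> x; have xx : y *m y^T @[y --> x] --> x *m x^T.
    exact: (cvg_mulmx (cid x) (cvg_trmx (cid x))).
  exact: (proj1 (cvg_mx_entries _ _) xx 0 0).
have compS : compact S.
  apply: (subclosed_compact _ (@rV_compact R n.+1 (fun=> `[-1, 1]%classic) _)).
  - exact: (proj1 (continuous_closedP _) cq [set 1] (@closed_eq _ _)).
  - by move=> _; exact: segment_compact.
  - move=> x; rewrite /S /= sqE => x1 i; rewrite in_itv /= -ler_norml.
    rewrite -(ler_pXn2r (n := 2)) ?nnegrE //.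
    rewrite expr1n real_normK ?num_real //.
    apply: (@le_trans _ _ (\sum_j x 0 j ^+ 2)); last by rewrite x1.
    by rewrite (bigD1 i) //= lerDl sumr_ge0 // => j _; exact: sqr_ge0.
have S0 : S !=set0.
  exists (delta_mx 0 0); rewrite /S /= trmx_delta mul_delta_mx.
  by rewrite mxE !eqxx.
have [x0 /set_mem x0S minx0] := compact_EVT_min S0 compS (continuous_subspaceT cf).
pose a := f x0; pose B := A - a%:M.
have BE (x : 'rV[R]_n.+1) : (x *m B *m x^T) 0 0 = f x - a * (x *m x^T) 0 0.
  rewrite mulmxBr mul_mx_scalar mulmxBl -scalemxAl.
  by rewrite /f; move: (x *m A *m x^T) (x *m x^T) => M N; rewrite !mxE.
have B_ge0 (x : 'rV[R]_n.+1) : 0 <= (x *m B *m x^T) 0 0.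
  rewrite BE subr_ge0.
  have : 0 <= (x *m x^T) 0 0 by rewrite sqE sumr_ge0 // => i _; exact: sqr_ge0.
  rewrite le_eqVlt => /orP[/eqP xx0|xx_gt0].
    suff -> : x = 0 by rewrite /f !mul0mx mxE mulr0.
    apply/rowP => i; rewrite mxE; apply/eqP; rewrite -sqrf_eq0.
    move: (esym xx0); rewrite sqE => /(psumr_eq0P (fun j _ => sqr_ge0 (x 0 j))) xi.
    by rewrite xi.
  set q := (x *m x^T) 0 0 in xx_gt0 *; pose c := (Num.sqrt q)^-1.
  have c2 : c ^+ 2 * q = 1.
    by rewrite exprVn sqr_sqrtr ?ltW // mulVf // gt_eqF.
  have cxS : c *: x \in S.
    by rewrite inE /S /= linearZ /= -scalemxAl -scalemxAr scalerA mxE -expr2.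
  have := minx0 _ cxS; rewrite {2}/f linearZ /= -!scalemxAl -scalemxAr scalerA.
  rewrite mxE -expr2 -/(f x) -/a => ale.
  by rewrite -[leRHS]mul1r -c2 mulrAC ler_wpM2r // ltW.
have symB : B^T = B by rewrite linearB /= symA tr_scalar_mx.
have Bx0 : (x0 *m B *m x0^T) 0 0 = 0 by rewrite BE x0S mulr1 subrr.
(* A nonnegative quadratic form vanishing at [x0] has [x0] in its kernel. *)
have x0B : x0 *m B = 0.
  pose y := x0 *m B; pose b := (y *m y^T) 0 0; pose d := (y *m B *m y^T) 0 0.
  have b_ge0 : 0 <= b by rewrite /b sqE sumr_ge0 // => i _; exact: sqr_ge0.
  have d_ge0 : 0 <= d by exact: B_ge0.
  have b0 : b = 0.
    (* With [u = b / (d + 1)] the form at this point is [- u ^+ 2 * (d + 2)], so [u = 0]. The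
       summand 1 keeps the denominator positive. *)
    have := B_ge0 (x0 + (- (b / (d + 1))) *: y).
    have e (M N K : 'M[R]_1) c c' :
        (M + c *: N + c' *: K) 0 0 = M 0 0 + c * N 0 0 + c' * K 0 0.
      by rewrite !mxE.
    rewrite quad_formD // e Bx0 -/y -/b -/d.
    set u := b / (d + 1); have bu : b = u * (d + 1).
      by rewrite /u divfK // gt_eqF // ltr_wpDl.
    have u_ge0 : 0 <= u by rewrite divr_ge0 // addr_ge0.
    rewrite bu; nra.
  apply/rowP => i; rewrite [RHS]mxE; apply/eqP; rewrite -sqrf_eq0.
  move: b0; rewrite /b sqE => /(psumr_eq0P (fun j _ => sqr_ge0 (y 0 j))) yi.
  by rewrite yi.
exists a; last by move=> x; have := B_ge0 x; rewrite BE subr_ge0.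
apply/eigenvalueP; exists x0.
  by apply/eqP; rewrite -subr_eq0 -mul_mx_scalar -mulmxBr x0B.
apply: contra_eq_neq x0S => ->; rewrite mul0mx mxE.
by rewrite eq_sym oner_neq0.
Qed.

(** A derivative bounded by [M] has difference quotient at most [2 * M / (b - 1)] between 1 and [b],
    which tends to 0 as [b] grows. *)
Lemma phi_P_le0 (R : realType) (P : R -> R) :
  differentiable_bounded_gradient P -> (phi_P P <= 0)%E.
Proof.
move=> [_ _ [M PM]]; rewrite leNgt; apply/negP => phi_gt0.
have M0 : 0 <= M by apply: le_trans (PM 1 ltr01); exact: normr_ge0.
have phi_le (b : R) : 1 < b -> (phi_P P <= (2 * M / (b - 1))%:E)%E.
  move=> b1; have b0 : 0 < b by lra.
  apply: (@le_trans _ _ ((derive1 P 1 - derive1 P b) / (1 - b))%:E).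
    apply: ereal_inf_lbound; exists 1, b; split => //.
    by rewrite lt_eqF.
  rewrite lee_fin -[1 - b]opprB invrN mulrN -mulNr ler_pM2r ?invr_gt0 ?subr_gt0 //.
  move: (PM _ b0) (PM 1 ltr01); rewrite !ler_norml; lra.
have := phi_le 2 ltac:(lra); move: phi_gt0 phi_le.
case: (phi_P P) => [c| |] //; rewrite lte_fin => c0 phi_le _.
(* For this [b], [c * (b - 1)] is [2 * M + c], which exceeds [2 * M]. *)
have b1 : 1 < 2 * M / c + 2.
  by have := divr_ge0 (mulr_ge0 (ler0n R 2) M0) (ltW c0); lra.
have := phi_le _ b1; rewrite lee_fin ler_pdivlMr ?subr_gt0 //.
set q := 2 * M / c; have qc : c * q = 2 * M by rewrite /q mulrC divfK // gt_eqF.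
by rewrite leNgt -qc => /negP; apply; nra.
Qed.

(** * The Frobenius norm and the projections *)

Section FrobeniusNorm.
Variables (R : realType) (m n : nat).
Implicit Types (A B : 'M[R]_(m, n)) (Omega : {set 'I_m * 'I_n}).

Lemma frob_norm0 : frob_norm (0 : 'M[R]_(m, n)) = 0.
Proof.
rewrite /frob_norm !big1 ?sqrtr0 // => i _.
by rewrite big1 // => j _; rewrite mxE expr0n.
Qed.

Lemma frob_normZ_sqr (t : R) A : frob_norm (t *: A) ^+ 2 = t ^+ 2 * frob_norm A ^+ 2.
Proof.
rewrite !frob_normE mulr_sumr; apply: eq_bigr => i _.
by rewrite mulr_sumr; apply: eq_bigr => j _; rewrite mxE exprMn.
Qed.

Lemma frob_norm_conv_sqr (t : R) A B :
  frob_norm ((1 - t) *: A + t *: B) ^+ 2 =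
  (1 - t) * frob_norm A ^+ 2 + t * frob_norm B ^+ 2
  - t * (1 - t) * frob_norm (A - B) ^+ 2.
Proof.
rewrite !frob_normE !mulr_sumr -big_split -sumrB; apply: eq_bigr => i _.
rewrite !mulr_sumr -big_split -sumrB; apply: eq_bigr => j _.
by rewrite !mxE /=; ring.
Qed.

Lemma entry_le_frob_norm A i j : `|A i j| <= frob_norm A.
Proof.
rewrite -(ler_pXn2r (n := 2)) ?nnegrE ?sqrtr_ge0 // frob_normE.
rewrite real_normK ?num_real // (bigD1 i) //= (bigD1 j) //= -addrA lerDl.
by apply: addr_ge0; rewrite !sumr_ge0 // => *;
  rewrite ?sumr_ge0 // => *; exact: sqr_ge0.
Qed.

Lemma P_OmegaZ Omega (t : R) A : P_Omega Omega (t *: A) = t *: P_Omega Omega A.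
Proof. by apply/matrixP => i j; rewrite !mxE; case: ifP; rewrite ?mulr0. Qed.

Lemma P_OmegaD Omega A B : P_Omega Omega (A + B) = P_Omega Omega A + P_Omega Omega B.
Proof. by apply/matrixP => i j; rewrite !mxE; case: ifP; rewrite ?addr0. Qed.

Lemma P_OmegaN Omega A : P_Omega Omega (- A) = - P_Omega Omega A.
Proof. by apply/matrixP => i j; rewrite !mxE; case: ifP; rewrite ?oppr0. Qed.

Lemma P_Omega_perpZ Omega (t : R) A :
  P_Omega_perp Omega (t *: A) = t *: P_Omega_perp Omega A.
Proof. by rewrite /P_Omega_perp P_OmegaZ scalerBr. Qed.

Lemma P_Omega_perp0 Omega : P_Omega_perp Omega 0 = 0 :> 'M[R]_(m, n).
Proof. by apply/matrixP => i j; rewrite !mxE if_same subrr. Qed.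

End FrobeniusNorm.

(** * The matrix [Theta] and bounded solutions of linear systems *)

Section Theta.
Variables (R : realType) (m n r : nat) (Omega : {set 'I_m * 'I_n}).
Implicit Types (U : 'M[R]_(m, r)) (V : 'M[R]_(n, r)) (s : 'rV[R]_r).

Lemma Theta_mul U V s :
  Theta Omega U V *m s^T = (mxvec (P_Omega Omega (U *m diag_mx s *m V^T)))^T.
Proof.
apply/matrixP => p k; rewrite ord1 {k} [LHS]mxE [RHS]mxE.
case/mxvec_indexP: p => i j; rewrite mxvecE mxE.
under eq_bigr do rewrite !mxE mxvecE mxE.
case: ifP => _; last by rewrite big1 // => k _; rewrite mul0r.
rewrite mxE; apply: eq_bigr => k _.
by rewrite mul_mx_diag !mxE big_ord1 !mxE; ring.
Qed.

(** The Gram form is the quadratic part of the data term in the coordinates [s], so its smallest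
    eigenvalue measures strong convexity. *)
Lemma Theta_gram U V s :
  (s *m ((Theta Omega U V)^T *m Theta Omega U V) *m s^T) 0 0 =
  frob_norm (P_Omega Omega (U *m diag_mx s *m V^T)) ^+ 2.
Proof.
set T := Theta Omega U V.
have -> : s *m (T^T *m T) *m s^T = (T *m s^T)^T *m (T *m s^T).
  by rewrite trmx_mul trmxK !mulmxA.
rewrite Theta_mul trmxK.
rewrite frob_normE mxE pair_bigA /= (reindex _ (curry_mxvec_bij m n)) /=.
by apply: eq_bigr => -[i j] _; rewrite mxE mxvecE expr2.
Qed.

Lemma cvg_Theta (T : Type) (F : set_system T) {FF : Filter F}
    (Uk : T -> 'M[R]_(m, r)) (Vk : T -> 'M[R]_(n, r)) U V :
  Uk x @[x --> F] --> U -> Vk x @[x --> F] --> V ->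
  Theta Omega (Uk x) (Vk x) @[x --> F] --> Theta Omega U V.
Proof.
move=> /cvg_mx_entries UkU /cvg_mx_entries VkV; apply/cvg_mx_entries => p k.
case/mxvec_indexP: p => i j; rewrite mxE mxvecE mxE.
under eq_fun do rewrite mxE mxvecE mxE.
case: ifP => _; last exact: cvg_cst.
rewrite mxE big_ord1 !mxE; under eq_fun do rewrite mxE big_ord1 !mxE.
by apply: cvgM; [exact: UkU|exact: VkV].
Qed.

End Theta.

(* A left inverse of the limit is almost a left inverse of [A x] near the limit. *)
Lemma bounded_solutions (R : realType) (p r : nat) (T : Type)
    (F : set_system T) {FF : Filter F}
    (A : T -> 'M[R]_(p, r)) (B : 'M[R]_(p, r)) (C : R) (sk : T -> 'rV[R]_r) :
  A x @[x --> F] --> B -> \rank B = r ->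
  (\forall x \near F, forall i, `|(A x *m (sk x)^T) i 0| <= C) ->
  exists K : R, \forall x \near F, forall i, `|sk x 0 i| <= K.
Proof.
move=> AB rankB ACle.
have /row_freeP[L BL] : row_free B^T by rewrite /row_free mxrank_tr rankB.
have LA1 : L^T *m A x @[x --> F] --> (1%:M : 'M[R]_r).
  rewrite -[1%:M]trmx1 -BL trmx_mul trmxK.
  by apply: cvg_mulmx => //; exact: cvg_cst.
(* Chosen so that [r%:R * e] is at most one half and the error term can be absorbed. *)
pose e : R := (2 * (r%:R + 1))^-1.
have r0 : 0 <= r%:R :> R by [].
have e0 : 0 < e by rewrite invr_gt0; lra.
pose K1 := \sum_i \sum_j `|L^T i j| * C.
exists (2 * (r%:R * K1)).
have LA1e : \forall x \near F, forall i j, `|(1%:M - L^T *m A x) i j| <= e.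
  apply: filter_forall => i; apply: filter_forall => j.
  move/cvg_mx_entries: LA1 => /(_ i j) /cvgrPdist_le /(_ _ e0).
  by apply: filterS => x; rewrite !mxE.
near=> x => i.
have xC : forall i, `|(A x *m (sk x)^T) i 0| <= C by near: x.
have xe : forall i j, `|(1%:M - L^T *m A x) i j| <= e by near: x.
set S := \sum_j `|sk x 0 j|.
have sS j : `|sk x 0 j| <= S.
  by rewrite /S (bigD1 j) //= lerDl sumr_ge0.
(* The vector is split into its image under the approximate inverse [L^T *m A x] and the small
   remainder. *)
have sle j : `|sk x 0 j| <= K1 + e * S.
  have -> : sk x 0 j = (L^T *m (A x *m (sk x)^T)) j 0
                       + ((1%:M - L^T *m A x) *m (sk x)^T) j 0.
    by rewrite mulmxBl mul1mx mulmxA [X in _ = _ + X]mxE [X in _ = _ + (_ + X)]mxE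
      addrC subrK mxE.
  apply: (le_trans (ler_normD _ _)); apply: lerD; rewrite mxE.
    apply: (le_trans (ler_norm_sum _ _ _)).
    rewrite /K1 (bigD1 j) //= -[leLHS]addr0; apply: lerD.
      by apply: ler_sum => k _; rewrite normrM ler_wpM2l.
    apply: sumr_ge0 => a _; apply: sumr_ge0 => b _; apply: mulr_ge0 => //.
    exact: le_trans (normr_ge0 _) (xC b).
  apply: (le_trans (ler_norm_sum _ _ _)); rewrite /S mulr_sumr.
  by apply: ler_sum => k _; rewrite normrM [_^T _ _]mxE ler_wpM2r.
(* Summing over the [r] coordinates puts [S] on both sides; absorbing half of it leaves
   [S <= 2 * (r%:R * K1)]. *)
have Sle : S <= r%:R * (K1 + e * S).
  rewrite mulr_natl -[r in leRHS]card_ord -sumr_const.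
  exact: ler_sum.
apply: (le_trans (sS i)).
have S0 : 0 <= S by rewrite sumr_ge0.
have re : r%:R * e <= 2^-1.
  rewrite /e invfM mulrCA ler_piMr // ler_pdivrMr; lra.
nra.
Unshelve. all: by end_near. Qed.


(** * Convergence through ultrafilters, and a small-step argument *)

(** If the preimage of a neighbourhood were not in [F], its complement together with [F] would
    extend to an ultrafilter along which [f] does not tend to [y]. This reduces convergence to
    uniqueness of ultrafilter limits. *)
Lemma cvg_ultrafilters (T : Type) (Y : topologicalType) (F : set_system T)
    (f : T -> Y) (y : Y) : Filter F ->
  (forall G, UltraFilter G -> F `<=` G -> f x @[x --> G] --> y) ->
  f x @[x --> F] --> y.
Proof.
move=> FF cvgG A Ay; apply: contrapT => nFA.
have wF : ProperFilter (within (~` (f @^-1` A)) F).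
  split; last exact: within_filter.
  move=> w0; apply: nFA; apply: (@filterS _ F _ _ _ _ w0) => x /= H.
  exact: contrapT.
have [G [uG wG]] := ultraFilterLemma wF.
have FG : F `<=` G by move=> B FB; apply: wG; apply: filterS FB.
have GA : G (f @^-1` A) by exact: cvgG.
have GnA : G (~` (f @^-1` A)) by apply: wG; exact: withinT.
by have [x []] := filter_ex (filterI GA GnA).
Qed.

Lemma nonpos_of_quadratic_bound (R : realType) (k K : R) : 0 <= K ->
  (forall t, 0 < t < 1 -> 2^-1 * (t * (1 - t)) * k <= t ^+ 2 * K) -> k <= 0.
Proof.
move=> K0 bound; rewrite leNgt; apply/negP => k0.
(* Divided by [t], the bound reads [k <= t * (k + 2 * K)]; this [t] makes the right side [k / 2]. *)
pose t := k / (2 * (k + 2 * K)).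
have den0 : 0 < 2 * (k + 2 * K) by lra.
have tE : t * (2 * (k + 2 * K)) = k by rewrite divfK // gt_eqF.
have t0 : 0 < t by rewrite divr_gt0.
have t1 : t < 1 by rewrite ltr_pdivrMr // mul1r; lra.
have := bound t; rewrite t0 t1 => /(_ isT).
rewrite [leLHS](_ : _ = t * (2^-1 * (1 - t) * k)); last by ring.
by rewrite expr2 -(mulrA t t) ler_pM2l //; lra.
Qed.

(** * Objective, surrogate and limits of singular value decompositions *)

Section Problem.
Variables (R : realType) (m n : nat) (Omega : {set 'I_m * 'I_n}).
Variables (Y : 'M[R]_(m, n)) (P : R -> R).

Definition objective (X : 'M[R]_(m, n)) : R :=
  2^-1 * frob_norm (P_Omega Omega (X - Y)) ^+ 2
  + \sum_(i < minn m n) P (singular_value X i).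

Lemma F_surrogateE l Z X :
  F_surrogate Omega Y P l Z X = objective Z
  + (2^-1 * frob_norm (P_Omega_perp Omega (Z - X)) ^+ 2
     + l / 2 * frob_norm (Z - X) ^+ 2).
Proof. rewrite /F_surrogate /objective; ring. Qed.

Lemma F_surrogate_id l X : F_surrogate Omega Y P l X X = objective X.
Proof.
by rewrite F_surrogateE subrr P_Omega_perp0 !frob_norm0 expr0n /= !mulr0 !addr0.
Qed.

Lemma objective_le_F_surrogate l Z X : 0 <= l ->
  objective Z <= F_surrogate Omega Y P l Z X.
Proof.
by move=> l0; rewrite F_surrogateE lerDl addr_ge0 // mulr_ge0 ?sqr_ge0 // divr_ge0.
Qed.

Lemma objective_argmin_le l X Z : 0 <= l -> argmin_F Omega Y P l X Z ->
  objective Z <= objective X.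
Proof.
move=> l0 /(_ X); rewrite F_surrogate_id; apply: le_trans.
exact: objective_le_F_surrogate.
Qed.

Lemma argmin_self_stationary l X :
  argmin_F Omega Y P l X X -> first_order_stationary Omega Y P l X.
Proof.
move=> argX; exists X => //; rewrite /Delta subrr P_Omega_perp0 !frob_norm0.
by rewrite expr0n /= mulr0 mule0 adde0.
Qed.

Lemma objective_ge X : nondecreasing_nonneg P ->
  2^-1 * frob_norm (P_Omega Omega (X - Y)) ^+ 2 + P 0 *+ minn m n <= objective X.
Proof.
move=> P_nd; rewrite lerD2l -[minn m n in leLHS]card_ord -sumr_const.
by apply: ler_sum => i _; apply: P_nd => //; exact: sqrtr_ge0.
Qed.

Lemma objective_svd r (U : 'M[R]_(m, r)) (s : 'rV[R]_r) (V : 'M[R]_(n, r)) :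
  U^T *m U = 1%:M -> V^T *m V = 1%:M -> (forall i, 0 <= s 0 i) ->
  objective (U *m diag_mx s *m V^T) =
  2^-1 * frob_norm (P_Omega Omega (U *m diag_mx s *m V^T - Y)) ^+ 2
  + (\sum_i P (s 0 i) + P 0 *+ (minn m n - r)).
Proof. by move=> U1 V1 s0; rewrite /objective sum_penalty_svd. Qed.

Hypothesis P_diff : differentiable_bounded_gradient P.

(** Orthonormality passes to the limit, while positivity of [sk] weakens to [0 <= s], so the rank
    may drop. The formula [objective_svd] still holds there and reduces the claim to continuity of
    the penalty. *)
Lemma svd_limit r (T : Type) (F : set_system T) {FF : ProperFilter F}
    (W : T -> 'M[R]_(m, n)) (Uk : T -> 'M[R]_(m, r)) (sk : T -> 'rV[R]_r)
    (Vk : T -> 'M[R]_(n, r)) (U : 'M[R]_(m, r)) (s : 'rV[R]_r) (V : 'M[R]_(n, r)) :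
  (\forall x \near F, rank_reduced_svd (W x) (Uk x) (sk x) (Vk x)) ->
  Uk x @[x --> F] --> U -> sk x @[x --> F] --> s -> Vk x @[x --> F] --> V ->
  let X := U *m diag_mx s *m V^T in
  [/\ U^T *m U = 1%:M, V^T *m V = 1%:M, (forall i, 0 <= s 0 i),
      W x @[x --> F] --> X & objective (W x) @[x --> F] --> objective X].
Proof.
move=> svdW UU ss VV X.
have gram p (Ak : T -> 'M[R]_(p, r)) (A : 'M[R]_(p, r)) :
    (\forall x \near F, (Ak x)^T *m Ak x = 1%:M) -> Ak x @[x --> F] --> A ->
    A^T *m A = 1%:M.
  move=> A1 AA.
  have AtA : (Ak x)^T *m Ak x @[x --> F] --> A^T *m A.
    exact: (cvg_mulmx (cvg_trmx AA) AA).
  have At1 : (Ak x)^T *m Ak x @[x --> F] --> (1%:M : 'M[R]_r).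
    exact: cvg_near_cst.
  exact: (norm_cvg_unique AtA At1).
have U1 : U^T *m U = 1%:M by apply: gram UU; apply: filterS svdW => x [].
have V1 : V^T *m V = 1%:M by apply: gram VV; apply: filterS svdW => x [].
have s0 i : 0 <= s 0 i.
  apply: (cvgr_to_ge (proj1 (cvg_mx_entries _ _) ss 0 i)).
  by apply: filterS svdW => x [_ _ _ sk0 _]; exact: ltW.
have cX : Uk x *m diag_mx (sk x) *m (Vk x)^T @[x --> F] --> X.
  exact: (cvg_mulmx (cvg_mulmx UU (cvg_diag_mx ss)) (cvg_trmx VV)).
split => //.
  by apply: cvg_trans cX; apply: near_eq_cvg; apply: filterS svdW => x [->].
rewrite objective_svd //.
(* Absolute values are inserted so that the continuous even extension of [P] applies; they are
   removed afterwards by sign. *)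
have : 2^-1 * frob_norm (P_Omega Omega (Uk x *m diag_mx (sk x) *m (Vk x)^T - Y)) ^+ 2
    + (\sum_i P `|sk x 0 i| + P 0 *+ (minn m n - r)) @[x --> F] -->
    2^-1 * frob_norm (P_Omega Omega (X - Y)) ^+ 2
    + (\sum_i P `|s 0 i| + P 0 *+ (minn m n - r)).
  apply: cvgD.
    apply: cvgM; first exact: cvg_cst.
    by apply: cvg_frob_norm_sqr; apply: cvg_P_Omega; apply: cvgB => //; exact: cvg_cst.
  apply: cvgD; last exact: cvg_cst.
  apply: cvg_sum => i.
  apply: (@continuous_cvg _ R R _ _ (fun x => sk x 0 i) (fun x => P `|x|)).
    exact: (continuous_penalty_norm P_diff).
  exact: (proj1 (cvg_mx_entries _ _) ss 0 i).
under [X in _ --> _ + (X + _) -> _]eq_bigr do rewrite ger0_norm //.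
apply: cvg_trans; apply: near_eq_cvg; apply: filterS svdW => x [-> U1x V1x sk0 _].
rewrite objective_svd //; last by move=> i; exact: ltW.
by under [X in _ + (X + _) = _]eq_bigr do rewrite gtr0_norm //.
Qed.

(** If [s] and [t] differed, convexity would lower the objective on the segment between them by a
    term of first order in the step, against a proximal cost of second order. *)
Lemma stationary_svd_unique r l (c : R) (U : 'M[R]_(m, r)) (V : 'M[R]_(n, r))
    (s t : 'rV[R]_r) :
  0 <= l -> (c%:E <= phi_P P)%E -> U^T *m U = 1%:M -> V^T *m V = 1%:M ->
  (forall i, 0 <= s 0 i) -> (forall i, 0 <= t 0 i) ->
  (forall x : 'rV[R]_r, x != 0 ->
     0 < (x *m ((Theta Omega U V)^T *m Theta Omega U V) *m x^T) 0 0
         + c * (x *m x^T) 0 0) ->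
  let X := U *m diag_mx s *m V^T in
  argmin_F Omega Y P l X X ->
  objective X = objective (U *m diag_mx t *m V^T) ->
  s = t.
Proof.
move=> l0 cphi U1 V1 s0 t0 posdef X argX eqobj.
apply/eqP; rewrite -subr_eq0; apply/negPn/negP => /posdef; rewrite Theta_gram.
set X' := U *m diag_mx t *m V^T in eqobj.
have XX' : U *m diag_mx (s - t) *m V^T = X - X'.
  by rewrite linearB /= mulmxBr mulmxBl.
have stE : ((s - t) *m (s - t)^T) 0 0 = \sum_i (s 0 i - t 0 i) ^+ 2.
  by rewrite mxE; apply: eq_bigr => i _; rewrite !mxE expr2.
rewrite XX' stE; set kappa := _ + _ => kappa0.
pose K := 2^-1 * frob_norm (P_Omega_perp Omega (X' - X)) ^+ 2
     + l / 2 * frob_norm (X' - X) ^+ 2.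
have comb (a : R) (A B : 'M[R]_(m, n)) : (1 - a) *: A + a *: B - A = a *: (B - A).
  by apply/matrixP => i j; rewrite !mxE; ring.
have combY (a : R) (A B : 'M[R]_(m, n)) :
    (1 - a) *: A + a *: B - Y = (1 - a) *: (A - Y) + a *: (B - Y).
  by apply/matrixP => i j; rewrite !mxE; ring.
have subPY (A B : 'M[R]_(m, n)) :
    P_Omega Omega (A - Y) - P_Omega Omega (B - Y) = P_Omega Omega (A - B).
  by rewrite -P_OmegaN -P_OmegaD opprB addrA subrK.
have K0 : 0 <= K.
  by apply: addr_ge0; apply: mulr_ge0; rewrite ?sqr_ge0 ?invr_ge0 ?divr_ge0 ?ler0n.
(* The left side is the convexity gain from the data term and the penalty, the right side the
   proximal cost of the step [tau *: (X' - X)]. *)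
have ineq (tau : R) : 0 < tau < 1 ->
    2^-1 * (tau * (1 - tau)) * kappa <= tau ^+ 2 * K.
  move=> /andP[tau0 tau1]; pose st := (1 - tau) *: s + tau *: t.
  have XE : U *m diag_mx st *m V^T = (1 - tau) *: X + tau *: X'.
    by rewrite linearD /= !linearZ /= mulmxDr mulmxDl -!scalemxAr -!scalemxAl.
  have st0 i : 0 <= st 0 i.
    rewrite !mxE; apply: addr_ge0; apply: mulr_ge0.
    - by rewrite subr_ge0; exact: ltW.
    - exact: s0.
    - exact: ltW.
    - exact: t0.
  have := argX (U *m diag_mx st *m V^T).
  rewrite F_surrogate_id F_surrogateE.
  have -> : U *m diag_mx st *m V^T - X = tau *: (X' - X).
    by rewrite XE comb.
  rewrite P_Omega_perpZ !frob_normZ_sqr.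
  rewrite (_ : _ + _ * (_ * _) = tau ^+ 2 * K); last by rewrite /K; ring.
  have convP : \sum_i P (st 0 i) <=
      (1 - tau) * (\sum_i P (s 0 i)) + tau * (\sum_i P (t 0 i))
      - c / 2 * (tau * (1 - tau)) * \sum_i (s 0 i - t 0 i) ^+ 2.
    rewrite !mulr_sumr -big_split -sumrB; apply: ler_sum => i _.
    rewrite !mxE; apply: (weak_convexity P_diff cphi (s0 i) (t0 i)).
    by rewrite tau0 tau1.
  move: eqobj; rewrite !objective_svd //.
  have -> : P_Omega Omega (U *m diag_mx st *m V^T - Y) =
      (1 - tau) *: P_Omega Omega (X - Y) + tau *: P_Omega Omega (X' - Y).
    by rewrite XE combY P_OmegaD !P_OmegaZ.
  rewrite frob_norm_conv_sqr.
  rewrite subPY.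
  move: convP; rewrite -/X -/X' /kappa.
  set S := \sum_i P (s 0 i); set S' := \sum_i P (t 0 i); set Sst := \sum_i P (st 0 i).
  set q := frob_norm (P_Omega _ (X - X')) ^+ 2.
  set a := frob_norm _ ^+ 2; set b := frob_norm _ ^+ 2; set d := \sum_i _.
  set e := P 0 *+ _.
  (* Multiplying the equality of objective values by [tau] beforehand leaves only linear
     arithmetic. *)
  set k := _ * K => convP /(congr1 (fun z => tau * z)); lra.
by have := nonpos_of_quadratic_bound K0 ineq; rewrite leNgt kappa0.
Qed.

End Problem.

(** * Fixing the number of columns, and the shifted Gram form *)

Lemma rank_reduced_svd_conform (R : realType) (m n d r : nat) (X : 'M[R]_(m, n))
    (U : 'M[R]_(m, d)) (s : 'rV[R]_d) (V : 'M[R]_(n, d)) : d = r ->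
  rank_reduced_svd X U s V ->
  rank_reduced_svd X (conform_mx (0 : 'M[R]_(m, r)) U) (conform_mx (0 : 'rV[R]_r) s)
    (conform_mx (0 : 'M[R]_(n, r)) V).
Proof. by move=> dr; case: _ / dr; rewrite !conform_mx_id. Qed.

(** The value [-oo] for [z] would make the sum [-oo], so [z] is finite; positivity then follows from
    the eigenvalue bound on the Gram form. *)
Lemma shifted_gram_gt0 (R : realType) (p r : nat) (T : 'M[R]_(p, r)) (z : \bar R) :
  (z < +oo)%E -> (0 < lambda_min (T^T *m T) + z)%E ->
  exists2 c : R, z = c%:E &
    forall x : 'rV[R]_r, x != 0 ->
      0 < (x *m (T^T *m T) *m x^T) 0 0 + c * (x *m x^T) 0 0.
Proof.
case: z => [c| |] //; last by rewrite addeNy.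
move=> _ lam; exists c => // x x0.
(* A nonzero [x] excludes [r = 0], where there is no eigenvalue and [lambda_min] is [+oo]. *)
have r0 : (0 < r)%N.
  by case: r T x lam x0 => // T x _ /eqP[]; apply/rowP => -[].
have symG : (T^T *m T)^T = T^T *m T by rewrite trmx_mul trmxK.
have [a eva ale] := symmetric_min_eigenvalue r0 symG.
have ac : 0 < a + c.
  rewrite -lte_fin EFinD; apply: (lt_le_trans lam); apply: leeD => //.
  by apply: ereal_inf_lbound; exists a.
apply: (@lt_le_trans _ _ ((a + c) * (x *m x^T) 0 0)).
  rewrite mulr_gt0 // lt_def; apply/andP; split; last first.
    by rewrite mxE sumr_ge0 // => i _; rewrite mxE -expr2 sqr_ge0.
  apply: contra x0; rewrite mxE psumr_eq0 => [/allP xi|i _]; last first.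
    by rewrite mxE -expr2 sqr_ge0.
  apply/eqP/rowP => i; rewrite [RHS]mxE; apply/eqP; rewrite -sqrf_eq0 expr2.
  by have := xi i (mem_index_enum i); rewrite mxE.
by rewrite mulrDl lerD2r.
Qed.

Lemma le_addr1_of_sqr_le (R : realType) (q B : R) : q ^+ 2 <= B -> q <= B + 1.
Proof. by have := sqr_ge0 (q - 1); have := sqr_ge0 q; nra. Qed.

(** * Limits along the subsequence *)

Section SubsequentialLimits.
Variables (R : realType) (m n : nat) (Omega : {set 'I_m * 'I_n}).
Variables (Y : 'M[R]_(m, n)) (P : R -> R) (l : R) (X : nat -> 'M[R]_(m, n)).
Hypothesis P_nondecreasing : nondecreasing_nonneg P.
Hypothesis P_diff : differentiable_bounded_gradient P.
Hypothesis l_ge0 : 0 <= l.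
Hypothesis X_step : forall k, argmin_F Omega Y P l (X k) (X k.+1).

Let obj := objective Omega Y P.
Let objlim := inf (range (obj \o X)).

Lemma objective_nonincreasing (j k : nat) : (j <= k)%N -> obj (X k) <= obj (X j).
Proof.
move=> /subnK <-; elim: (k - j)%N => [|i IH]; first exact: lexx.
rewrite addSn.
by apply: le_trans IH; exact: objective_argmin_le (X_step _).
Qed.

Lemma objective_lbound : has_lbound (range (obj \o X)).
Proof.
exists (P 0 *+ minn m n) => _ [k _ <-].
apply: le_trans (objective_ge Omega Y (X k) P_nondecreasing).
by rewrite lerDr mulr_ge0 ?sqr_ge0.
Qed.

Lemma objective_cvg : obj (X k) @[k --> \oo] --> objlim.
Proof.
apply: nonincreasing_cvgn; last exact: objective_lbound.
exact: objective_nonincreasing.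
Qed.

Lemma objlim_le k : objlim <= obj (X k).
Proof. by apply: ge_inf; [exact: objective_lbound|exists k]. Qed.

(** The filter [G] is any refinement of [\oo], so that the result serves both for ultrafilters and
    for [\oo] itself. *)
Lemma subseq_limit_argmin (nk : nat -> nat) (G : set_system nat) {GG : ProperFilter G}
    (Xbar : 'M[R]_(m, n)) :
  {homo nk : i j / (i < j)%N} -> \oo `<=` G ->
  X (nk k) @[k --> G] --> Xbar ->
  obj (X (nk k)) @[k --> G] --> obj Xbar ->
  obj Xbar = objlim /\ argmin_F Omega Y P l Xbar Xbar.
Proof.
move=> nk_incr ooG XX objX.
have nk_ge k : (k <= nk k)%N.
  by elim: k => // k IH; exact: leq_ltn_trans IH (nk_incr _ _ (ltnSn k)).
have objoo : obj (X (nk k)) @[k --> G] --> objlim.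
  apply: cvg_trans objective_cvg => A [N _ NA]; apply: ooG.
  exists N => [|k Nk]; first exact: I.
  exact: NA (leq_trans Nk (nk_ge k)).
have objE : obj Xbar = objlim by exact: (norm_cvg_unique objX objoo).
split=> [|Z]; first exact: objE.
rewrite F_surrogate_id -/(obj _) objE.
have FZ : F_surrogate Omega Y P l Z (X (nk k)) @[k --> G] -->
    F_surrogate Omega Y P l Z Xbar.
  rewrite F_surrogateE; under eq_fun do rewrite F_surrogateE.
  have ZX : Z - X (nk k) @[k --> G] --> Z - Xbar.
    exact: (cvgB (cvg_cst Z) XX).
  apply: (cvgD (cvg_cst _)).
  exact: (cvgD (cvgM (cvg_cst _) (cvg_frob_norm_sqr (cvg_P_Omega_perp ZX)))
    (cvgM (cvg_cst _) (cvg_frob_norm_sqr ZX))).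
apply: (cvgr_to_ge FZ); near=> k.
(* The chain runs from [objlim] to the objective at the next iterate, to its surrogate value, to the
   surrogate value of [Z]. *)
apply: le_trans (X_step (nk k) Z); apply: le_trans (objlim_le (nk k).+1) _.
exact: objective_le_F_surrogate.
Unshelve. all: by end_near. Qed.

Lemma P_Omega_iterates_bounded : exists C : R, forall k i j,
  `|P_Omega Omega (X k) i j| <= C.
Proof.
(* Descent and the lower bound on the penalty sum give [B] as a bound for the squared residual on
   [Omega] at every iterate. *)
pose B := 2 * (obj (X 0) - P 0 *+ minn m n).
exists (B + 1 + frob_norm (P_Omega Omega Y)) => k i j.
rewrite -[X k](subrK Y) P_OmegaD mxE; apply: (le_trans (ler_normD _ _)).
apply: lerD; last exact: entry_le_frob_norm.
apply: (le_trans (entry_le_frob_norm _ i j)).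
apply: le_addr1_of_sqr_le.
have := le_trans (objective_ge Omega Y (X k) P_nondecreasing)
  (objective_nonincreasing (leq0n k)).
by rewrite -lerBrDr ler_pdivrMl ?ltr0n.
Qed.

Variables (r : nat) (Uk : nat -> 'M[R]_(m, r)) (sk : nat -> 'rV[R]_r).
Variables (Vk : nat -> 'M[R]_(n, r)) (Ubar : 'M[R]_(m, r)) (Vbar : 'M[R]_(n, r)).
Variable nk : nat -> nat.
Hypothesis nk_incr : {homo nk : i j / (i < j)%N}.
Hypothesis svdX :
  \forall k \near \oo, rank_reduced_svd (X (nk k)) (Uk k) (sk k) (Vk k).
Hypothesis U_cvg : Uk k @[k --> \oo] --> Ubar.
Hypothesis V_cvg : Vk k @[k --> \oo] --> Vbar.

(** Full column rank bounds the vectors [sk k] in a compact box; there the ultrafilter has a cluster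
    point, and a cluster point of an ultrafilter is its limit. *)
Lemma singular_values_ultra_cvg : \rank (Theta Omega Ubar Vbar) = r ->
  forall G, UltraFilter G -> \oo `<=` G -> exists t : 'rV[R]_r, sk k @[k --> G] --> t.
Proof.
move=> rankT G uG ooG; have [C XC] := P_Omega_iterates_bounded.
have TC : \forall k \near \oo, forall p,
    `|(Theta Omega (Uk k) (Vk k) *m (sk k)^T) p 0| <= C.
  apply: filterS svdX => k [Xk _ _ _ _] p; rewrite Theta_mul -Xk mxE.
  by case/mxvec_indexP: p => i j; rewrite mxvecE.
have [K sK] := bounded_solutions (cvg_Theta U_cvg V_cvg) rankT TC.
have [|t [_ tG]] := @rV_compact R r (fun=> `[- K, K]%classic)
    (fun=> @segment_compact _ _ _) (sk k @[k --> G]) _.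
  by apply: ooG; apply: filterS sK => k sK i; rewrite /= in_itv /= -ler_norml.
exists t => A At; have [//|GnA] := in_ultra_setVsetC (sk @^-1` A) uG.
by have [x [nAx /nAx]] := tG (~` A) A GnA At.
Qed.

Lemma limit_stationary (G : set_system nat) {GG : ProperFilter G} (t : 'rV[R]_r) :
  \oo `<=` G -> sk k @[k --> G] --> t ->
  let Xt := Ubar *m diag_mx t *m Vbar^T in
  [/\ [/\ Ubar^T *m Ubar = 1%:M, Vbar^T *m Vbar = 1%:M & forall i, 0 <= t 0 i],
      X (nk k) @[k --> G] --> Xt, obj Xt = objlim & argmin_F Omega Y P l Xt Xt].
Proof.
move=> ooG st Xt.
have UG : Uk k @[k --> G] --> Ubar by move=> A /U_cvg; exact: ooG.
have VG : Vk k @[k --> G] --> Vbar by move=> A /V_cvg; exact: ooG.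
have [U1 V1 t0 XX objX] := svd_limit Omega Y P_diff (ooG _ svdX) UG st VG.
by have [? ?] := subseq_limit_argmin nk_incr ooG XX objX.
Qed.

Lemma stationary_limit_point : \rank (Theta Omega Ubar Vbar) = r ->
  exists2 Xbar : 'M[R]_(m, n),
    cluster (X (nk k) @[k --> \oo]) Xbar & first_order_stationary Omega Y P l Xbar.
Proof.
move=> rankT; have [G [uG ooG]] := ultraFilterLemma (@eventually_filter).
have [t tG] := singular_values_ultra_cvg rankT uG ooG.
have [_ XX _ argX] := limit_stationary ooG tG.
exists (Ubar *m diag_mx t *m Vbar^T); last exact: argmin_self_stationary.
(* A limit along a filter finer than [\oo] is a cluster point of the sequence. *)
move=> A B ooA BX; have GA : G ((fun k => X (nk k)) @^-1` A) by exact: ooG.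
exact: filter_ex (filterI GA (XX _ BX)).
Qed.

Lemma stationary_limit :
  (0 < lambda_min ((Theta Omega Ubar Vbar)^T *m Theta Omega Ubar Vbar) + phi_P P)%E ->
  exists sbar : 'rV[R]_r,
    [/\ sk k @[k --> \oo] --> sbar,
        X (nk k) @[k --> \oo] --> Ubar *m diag_mx sbar *m Vbar^T &
        first_order_stationary Omega Y P l (Ubar *m diag_mx sbar *m Vbar^T)].
Proof.
have phi0 := phi_P_le0 P_diff.
move=> /(shifted_gram_gt0 (le_lt_trans phi0 (ltry 0)))[c phiE posdef].
have c0 : c <= 0 by rewrite -lee_fin -phiE.
(* On a kernel vector the Gram form vanishes and the term with [c <= 0] is nonpositive, against
   positive definiteness. *)
have rankT : \rank (Theta Omega Ubar Vbar) = r.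
  rewrite -mxrank_tr; apply/eqP; apply: inj_row_free => x xT.
  apply: contrapT => /eqP /posdef; rewrite mulmxA xT !mul0mx mxE add0r.
  rewrite ltNge mulr_le0_ge0 // mxE sumr_ge0 // => i _.
  by rewrite mxE -expr2 sqr_ge0.
have [G [uG ooG]] := ultraFilterLemma (@eventually_filter).
have [t tG] := singular_values_ultra_cvg rankT uG ooG.
have [[U1 V1 t0] _ objt argt] := limit_stationary ooG tG.
(* Every ultrafilter finer than [\oo] yields a limit with the same objective value [objlim], hence
   the same vector [t]. *)
have st : sk k @[k --> \oo] --> t.
  apply: cvg_ultrafilters => H uH ooH.
  have [t' tH] := singular_values_ultra_cvg rankT uH ooH.
  have [[_ _ t'0] _ objt' _] := limit_stationary ooH tH.
  suff -> : t = t' by [].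
  apply: (stationary_svd_unique P_diff l_ge0 _ U1 V1 t0 t'0 posdef argt).
    by rewrite phiE.
  by rewrite -/obj objt objt'.
exists t; split=> //; last exact: argmin_self_stationary.
by have [_ XX _ _] := limit_stationary (@subset_refl _ _) st.
Qed.

End SubsequentialLimits.

Theorem proposition11 (R : realType) (m n : nat) (hm : (0 < m)%N) (hn : (0 < n)%N)
  (Omega : {set 'I_m * 'I_n}) (Y : 'M[R]_(m, n)) (P : R -> R)
  (P_concave : concave_nonneg P)
  (P_nondecreasing : nondecreasing_nonneg P)
  (P_diff : differentiable_bounded_gradient P)
  (l : R) (hl : 0 <= l)
  (X : nat -> 'M[R]_(m, n))
  (X_step : forall k, argmin_F Omega Y P l (X k) (X k.+1))
  (d : nat -> nat)
  (U : forall k, 'M[R]_(m, d k)) (s : forall k, 'rV[R]_(d k))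
  (V : forall k, 'M[R]_(n, d k))
  (X_svd : forall k, rank_reduced_svd (X k) (U k) (s k) (V k))
  (r : nat) (Ubar : 'M[R]_(m, r)) (Vbar : 'M[R]_(n, r))
  (nk : nat -> nat) (nk_incr : {homo nk : i j / (i < j)%N})
  (U_cvg : cvg_mx (fun k => U (nk k)) Ubar)
  (V_cvg : cvg_mx (fun k => V (nk k)) Vbar) :
  (\rank (Theta Omega Ubar Vbar) = r ->
     exists2 Xbar : 'M[R]_(m, n),
       cluster (X (nk k) @[k --> \oo]) Xbar &
       first_order_stationary Omega Y P l Xbar)
  /\
  ((0 < lambda_min ((Theta Omega Ubar Vbar)^T *m Theta Omega Ubar Vbar)
        + phi_P P)%E ->
     exists sbar : 'rV[R]_r,
       [/\ cvg_mx (fun k => s (nk k)) sbar,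
           X (nk k) @[k --> \oo] --> Ubar *m diag_mx sbar *m Vbar^T &
           first_order_stationary Omega Y P l
             (Ubar *m diag_mx sbar *m Vbar^T)]).
Proof.
have [dr UU] := U_cvg; have [_ VV] := V_cvg.
(* Eventually [d (nk k)] is [r], so [conform_mx] is the identity there and all factors have a fixed
   shape. *)
have svdX : \forall k \near \oo, rank_reduced_svd (X (nk k))
    (conform_mx (0 : 'M[R]_(m, r)) (U (nk k))) (conform_mx (0 : 'rV[R]_r) (s (nk k)))
    (conform_mx (0 : 'M[R]_(n, r)) (V (nk k))).
  by apply: filterS dr => k dr; exact: rank_reduced_svd_conform.
split; first exact: stationary_limit_point svdX UU VV.
move=> /(stationary_limit P_nondecreasing P_diff hl X_step nk_incr svdX UU VV).
by move=> [sbar [scvg Xcvg stat]]; exists sbar; split.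
Qed.
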